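(* Let $N\ge 1$ be an integer, $\mathbb{B}=\{0,1\}$, and let $E_k, D_k:\mathbb{B}^N\to\mathbb{B}^N$ (the encryption and decryption functions of a block cipher with fixed key $k$) satisfy $E_k\circ D_k=\mathrm{id}$. Let $\chi=\mathbb{B}^N\times\mathcal{S}_N$, with metric $d$ and CBC map $G:\chi\to\chi$, $G(x,m)=(E_k(x\oplus m^0),\sigma(m))$, as defined in the context. Then $G$ has sensitive dependence on initial conditions on $(\chi,d)$, with a constant of sensitivity larger than $N$: there exists $\delta>N$ such that for every $X\in\chi$ and every neighborhood $V$ of $X$ there exist $Y\in V$ and an integer $n>0$ with $d(G^n(X),G^n(Y))>\delta$.
   Context: $\mathcal{S}_N$ is the set of infinite sequences $m=(m^0,m^1,m^2,\dots)$ of $N$-bit blocks $m^j=(m^j_1,\dots,m^j_N)\in\mathbb{B}^N$ (equivalently, integers in $\{0,\dots,2^N-1\}$ written in binary). The shift is $\sigma(m^0,m^1,m^2,\dots)=(m^1,m^2,m^3,\dots)$. The symbol $\oplus$ is the bitwise exclusive or on $\mathbb{B}^N$. The phase space is $\chi=\mathbb{B}^N\times\mathcal{S}_N$ (internal state, message). The CBC (cipher block chaining) mode of operation is modeled by the discrete dynamical system $X^0=(IV,m)$, $X^{n+1}=G(X^n)$, with $G(x,m)=(E_k(x\oplus m^0),\sigma(m))$; $G^n$ is the $n$-th iterate of $G$. The distance on $\chi$ is $d((x,m),(\check x,\check m))=d_e(x,\check x)+d_m(m,\check m)$, where $$d_e(x,\check x)=\sum_{j=1}^N\delta_0(x_j,\check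 x_j),\qquad d_m(m,\check m)=\frac{9}{N}\sum_{j=1}^{\infty}\frac{\sum_{i=1}^N|m^{j-1}_i-\check m^{j-1}_i|}{10^j},$$ with $\delta_0(a,b)=0$ if $a=b$ and $1$ otherwise. A map $f$ on a metric space $(\chi,d)$ has sensitive dependence on initial conditions if there is $\delta>0$ such that for any $x\in\chi$ and any neighborhood $V$ of $x$ there exist $y\in V$ and $n>0$ with $d(f^n(x),f^n(y))>\delta$; such a $\delta$ is called a constant of sensitivity of $f$. *)

(* Defs.v *)
From HB Require Import structures.
From mathcomp Require Import all_boot all_order all_algebra.
From mathcomp Require Import all_classical all_reals all_analysis.
Set Implicit Arguments.
Unset Strict Implicit.
Unset Printing Implicit Defensive.

Import Order.TTheory GRing.Theory Num.Theory.
Import numFieldNormedType.Exports.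

Local Open Scope classical_set_scope.
Local Open Scope ring_scope.

Definition block (N : nat) := {ffun 'I_N -> bool}.

Definition message (N : nat) := nat -> block N.

Definition xorb_block N (x y : block N) : block N := [ffun i => x i (+) y i].

Definition shift N (m : message N) : message N := fun j => m j.+1.

(* [R] is a phantom parameter: it lets the real field in which distances are
   measured be inferred from the carrier, and the alias keeps the metric below
   apart from the product uniform structure that the library puts on
   [block N * message N]. *)
Definition phase (R : realType) (N : nat) : Type := (block N * message N)%type.

Definition dist_block (R : realType) N (x y : block N) : R :=
  \sum_(i < N) (x i != y i)%:R.

Definition message_term (R : realType) N (m m' : message N) (j : nat) : R :=
  (\sum_(i < N) `|(m j.-1 i)%:R - (m' j.-1 i)%:R|) / 10 ^+ j.

Definition dist_message (R : realType) N (m m' : message N) : R :=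
  9 / N%:R * \big[+%R/0]_(1 <= j <oo) message_term R m m' j.

Definition dist_phase (R : realType) N (X Y : phase R N) : R :=
  dist_block R X.1 Y.1 + dist_message R X.2 Y.2.

Definition cbc (R : realType) N (Ek : block N -> block N) (X : phase R N) :
  phase R N := (Ek (xorb_block X.1 (X.2 0%N)), shift X.2).

Section phase_metric.
Context (R : realType) (N : nat).
Implicit Types (x y z : block N) (m p q : message N) (X Y Z : phase R N).

Let S m p j : R := \sum_(i < N) `|(m j i)%:R - (p j i)%:R|.
Let T m p n : R := \sum_(1 <= j < n) message_term R m p j.

Let S_ge0 m p j : 0 <= S m p j.
Proof. by apply: sumr_ge0. Qed.

Let S_le m p j : S m p j <= N%:R.
Proof.
rewrite -[leRHS](_ : \sum_(i < N) 1 = _); last first.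
  by rewrite sumr_const card_ord.
apply: ler_sum => i _.
case: (m j i); case: (p j i);
  by rewrite ?subrr ?subr0 ?sub0r ?normrN ?normr0 ?normr1.
Qed.

Let term_ge0 m p j : 0 <= message_term R m p j.
Proof. by rewrite divr_ge0 ?S_ge0// exprn_ge0. Qed.

Let T_ndecr m p : nondecreasing_seq (T m p).
Proof.
apply/nondecreasing_seqP => -[|n]; first by rewrite /T !big_geq.
by rewrite /T [leRHS]big_nat_recr//= lerDl.
Qed.

Lemma cvg_message_term m p :
  cvgn (fun n => \sum_(1 <= j < n) message_term R m p j).
Proof.
rewrite (@is_cvg_series_restrict 1 R R^o).
apply: (@series_le_cvg _ _ (geometric N%:R 10^-1)) => [//|j|j|].
- by rewrite /= mulr_ge0// exprn_ge0// invr_ge0.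
- rewrite /= exprVn ler_wpM2r ?invr_ge0 ?exprn_ge0//; exact: S_le.
- apply: is_cvg_geometric_series.
  by rewrite ger0_norm ?invr_ge0// invf_lt1// ltr1n.
Qed.

Let T_cvg m p : cvgn (T m p). Proof. exact: cvg_message_term. Qed.

Let dist_messageE m p : dist_message R m p = 9 / N%:R * limn (T m p).
Proof. by []. Qed.

Let term_le_lim m p j : S m p j / 10 ^+ j.+1 <= limn (T m p).
Proof.
apply: le_trans (nondecreasing_cvgn_le (@T_ndecr m p) (@T_cvg m p) j.+2).
by rewrite /T [leRHS]big_nat_recr//= lerDr sumr_ge0.
Qed.

Let lim_ge0 m p : 0 <= limn (T m p).
Proof.
by apply: le_trans (term_le_lim m p 0); rewrite divr_ge0 ?S_ge0// exprn_ge0.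
Qed.

Let c_ge0 : 0 <= 9 / N%:R :> R.
Proof. by rewrite divr_ge0. Qed.

Let dist_block_ge0 x y : 0 <= dist_block R x y.
Proof. by apply: sumr_ge0. Qed.

Let dist_message_ge0 m p : 0 <= dist_message R m p.
Proof. by rewrite dist_messageE mulr_ge0. Qed.

Lemma dist_phasexx X : dist_phase X X = 0.
Proof.
rewrite /dist_phase /dist_block dist_messageE.
rewrite big1 => [|i _]; last by rewrite eqxx.
rewrite add0r (_ : T _ _ = cst 0) ?lim_cst ?mulr0//.
apply/funext => n; rewrite /T big1//= => j _.
by rewrite /message_term big1 ?mul0r// => i _; rewrite subrr normr0.
Qed.

Lemma dist_phase_positivity X Y : dist_phase X Y = 0 -> X = Y.
Proof.
move=> /eqP; rewrite paddr_eq0// => /andP[/eqP dx /eqP dm].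
case: X Y dx dm => [x m] [y p] /= dx dm; congr pair.
  apply/ffunP => i; apply/eqP/negP => /negP xy.
  move/eqP: dx; rewrite psumr_eq0// => /allP/(_ i (mem_index_enum i))/=.
  by rewrite xy oner_eq0.
apply/funext => j; apply/ffunP => i.
have N0 : N%:R != 0 :> R by rewrite pnatr_eq0; case: N i => [[]|].
move/eqP: dm; rewrite dist_messageE mulf_eq0 mulf_eq0 invr_eq0 (negbTE N0).
rewrite pnatr_eq0/= => /eqP T0.
have : S m p j / 10 ^+ j.+1 <= 0 by rewrite -T0.
rewrite pmulr_lle0 ?invr_gt0 ?exprn_gt0// => S0.
have /eqP : S m p j = 0 by apply/eqP; rewrite eq_le S0 S_ge0.
rewrite psumr_eq0// => /allP/(_ i (mem_index_enum i))/=.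
rewrite normr_eq0 subr_eq0 eqr_nat.
by case: (m j i); case: (p j i).
Qed.

Lemma dist_phase_sym X Y : dist_phase X Y = dist_phase Y X.
Proof.
congr +%R; first by apply: eq_bigr => i _; rewrite eq_sym.
rewrite !dist_messageE (_ : T X.2 Y.2 = T Y.2 X.2)//; apply/funext => n.
apply: eq_bigr => j _; congr (_ / _); apply: eq_bigr => i _.
by rewrite distrC.
Qed.

Lemma dist_phase_triangle Y X Z :
  dist_phase X Z <= dist_phase X Y + dist_phase Y Z.
Proof.
rewrite /dist_phase addrACA lerD//.
  rewrite -big_split; apply: ler_sum => i _.
  by case: (X.1 i); case: (Y.1 i); case: (Z.1 i); rewrite /= -natrD ler_nat.
rewrite !dist_messageE -mulrDr ler_wpM2l// -limD; try exact: T_cvg.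
apply: ler_lim; [exact: T_cvg|by apply: is_cvgD; exact: T_cvg|].
apply: nearW => n.
rewrite [leRHS](_ : _ = T X.2 Y.2 n + T Y.2 Z.2 n)// /T -big_split.
apply: ler_sum => j _; rewrite /= /message_term -mulrDl ler_wpM2r ?invr_ge0 ?exprn_ge0//.
by rewrite -big_split; apply: ler_sum => i _; exact: ler_distD.
Qed.

HB.instance Definition _ := Choice.copy (phase R N) (block N * message N)%type.

HB.instance Definition _ := isMetric.Build R (phase R N)
  dist_phasexx dist_phase_positivity dist_phase_sym dist_phase_triangle.

Lemma mdist_phaseE X Y : mdist X Y = dist_phase X Y. Proof. by []. Qed.

End phase_metric.

Definition is_sensitivity_constant (R : realType) (T : metricType R)
    (f : T -> T) (delta : R) :=
  0 < delta /\
  forall (x : T) (V : set T), nbhs x V ->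
    exists2 y, V y & exists2 n, (0 < n)%N &
      delta < mdist (iter n f x) (iter n f y).

(* Main.v *)
(** To separate a trajectory from a given one, change the message far out.  The
    states agree until the first modified block, and since [Ek] is onto that
    block can be chosen so that the next two states differ in all [N] bits;
    complementing all later blocks then makes the message parts at least [9/10]
    apart at that time. *)
Require Import Defs.
From mathcomp Require Import all_boot all_order all_algebra.
From mathcomp Require Import all_classical all_reals all_analysis.
From mathcomp Require Import lra.
Set Implicit Arguments.
Unset Strict Implicit.
Unset Printing Implicit Defensive.

Import Order.TTheory GRing.Theory Num.Theory.
Import numFieldNormedType.Exports.

Local Open Scope classical_set_scope.
Local Open Scope ring_scope.

Definition negb_block N (x : block N) : block N := [ffun i => ~~ x i].

Lemma xorb_blockK N (x y : block N) : xorb_block x (xorb_block x y) = y.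
Proof. by apply/ffunP => i; rewrite !ffunE addbA addbb. Qed.

Section distances.
Context (R : realType) (N : nat).
Implicit Types (x : block N) (m p : message N).

Lemma dist_block_negb x : dist_block R x (negb_block x) = N%:R.
Proof.
rewrite /dist_block (eq_bigr (fun=> 1)) => [|i _].
  by rewrite sumr_const card_ord.
by rewrite ffunE; case: (x i).
Qed.

Lemma dist_blockxx x : dist_block R x x = 0.
Proof. by rewrite /dist_block big1// => i _; rewrite eqxx. Qed.

Lemma message_term_ge0 m p j : 0 <= message_term R m p j.
Proof. by rewrite divr_ge0 ?exprn_ge0//; exact: sumr_ge0. Qed.

Lemma message_term_le m p j : message_term R m p j <= N%:R / 10 ^+ j.
Proof.
rewrite ler_wpM2r ?invr_ge0 ?exprn_ge0//.
rewrite -[leRHS](_ : \sum_(i < N) 1 = _); last first.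
  by rewrite sumr_const card_ord.
apply: ler_sum => i _; case: (m _ i); case: (p _ i);
  by rewrite ?subrr ?subr0 ?sub0r ?normrN ?normr0 ?normr1.
Qed.

Lemma message_term_eq0 m p j : m j.-1 = p j.-1 -> message_term R m p j = 0.
Proof.
by move=> mp; rewrite /message_term big1 ?mul0r// => i _; rewrite mp subrr normr0.
Qed.

Lemma message_term_negb m p j : p j.-1 = negb_block (m j.-1) ->
  message_term R m p j = N%:R / 10 ^+ j.
Proof.
move=> mp; congr (_ / _).
rewrite (eq_bigr (fun=> 1)) => [|i _]; first by rewrite sumr_const card_ord.
by rewrite mp ffunE; case: (m _ i); rewrite ?subr0 ?sub0r ?normrN ?normr1.
Qed.

(** Terms up to index [k] vanish and a later one is at most [N / 10 ^ j]; the right-hand side is the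
    exact sum of these bounds, so the induction on [d] loses nothing. *)
Lemma sum_message_term_le m p k d : (forall j, (j < k)%N -> m j = p j) ->
  \sum_(1 <= j < (k + d).+1) message_term R m p j
    <= N%:R / 9 * (10 ^- k - 10 ^- (k + d)).
Proof.
move=> mp; elim: d => [|d IH].
  rewrite addn0 subrr mulr0 big_nat big1// => j /andP[j0 jk].
  (* The term of index [j] compares blocks [j - 1], so [j <= k] only involves blocks below [k]. *)
  by apply: message_term_eq0; apply: mp; rewrite -ltnS prednK.
rewrite addnS big_nat_recr//=.
apply: le_trans (lerD IH (message_term_le _ _ _)) _.
rewrite exprSr invfM; lra.
Qed.

(** The weight [9 / N] cancels the factor [N / 9] of the geometric tail. This makes long common
    prefixes give small distances. *)
Lemma dist_message_le m p k : (0 < N)%N -> (forall j, (j < k)%N -> m j = p j) ->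
  dist_message R m p <= 10 ^- k.
Proof.
move=> N0 mp; have N0' : 0 < N%:R :> R by rewrite ltr0n.
rewrite /dist_message -[leRHS](_ : 9 / N%:R * (N%:R / 9 * 10 ^- k) = _); last first.
  by rewrite mulrA mulf_div mulrC [9 * _]mulrC divff ?mulr1// mulf_neq0// gt_eqF.
rewrite ler_wpM2l ?divr_ge0//.
apply: limr_le; first exact: cvg_message_term.
near=> n.
have kn : (k.+1 <= n)%N by near: n; exact: nbhs_infty_ge.
rewrite -(subnK kn) addnC addSn.
apply: le_trans (sum_message_term_le _ mp) _.
by rewrite ler_wpM2l ?divr_ge0// gerBl invr_ge0 exprn_ge0.
Unshelve. all: by end_near. Qed.

(** The term of index 1 alone contributes [9 / N * (N / 10)], and the others are nonnegative. *)
Lemma dist_message_ge m p : (0 < N)%N -> p 0%N = negb_block (m 0%N) ->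
  9 / 10 <= dist_message R m p.
Proof.
move=> N0 mp; have N0' : 0 < N%:R :> R by rewrite ltr0n.
rewrite /dist_message -[leLHS](_ : 9 / N%:R * (N%:R / 10) = _); last first.
  by rewrite mulrA divfK// gt_eqF.
rewrite ler_wpM2l ?divr_ge0//.
apply: limr_ge; first exact: cvg_message_term.
near=> n.
have n2 : (1 < n)%N by near: n; exact: nbhs_infty_ge.
rewrite big_ltn// (@message_term_negb m p 1)// expr1 lerDl.
by apply: sumr_ge0 => j _; exact: message_term_ge0.
Unshelve. all: by end_near. Qed.

End distances.

Section trajectories.
Context (R : realType) (N : nat) (Ek : block N -> block N).
Implicit Types X Y : phase R N.

Lemma iter_cbc_message X n j : (iter n (cbc Ek) X).2 j = X.2 (n + j)%N.
Proof.
by elim: n j => [//|n IH] j; rewrite iterS /= /Defs.shift IH addnS addSn.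
Qed.

Lemma iter_cbc_state X Y n : X.1 = Y.1 ->
  (forall j, (j < n)%N -> X.2 j = Y.2 j) ->
  (iter n (cbc Ek) X).1 = (iter n (cbc Ek) Y).1.
Proof.
move=> XY; elim: n => [//|n IH] mXY; rewrite !iterS /= !iter_cbc_message addn0.
by rewrite mXY// IH// => j jn; apply: mXY; exact: ltnW.
Qed.

End trajectories.

Theorem mainTheorem1 (R : realType) (N : nat) (hN : (1 <= N)%N)
    (Ek Dk : block N -> block N) (hED : forall b, Ek (Dk b) = b) :
  exists delta : R, (N%:R < delta)%R /\
    is_sensitivity_constant (cbc Ek : phase R N -> phase R N) delta.
Proof.
(* The states will contribute exactly [N] and the messages at least [9 / 10]; [1 / 2] lies strictly
   between 0 and [9 / 10]. *)
exists (N%:R + 1 / 2); split; first lra.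
split; first by rewrite ltr_wpDl// divr_gt0.
move=> X V /nbhs_ballP[e /= e0 XeV].
have [k ke] : exists k, 10 ^- k < e :> R.
  have /cvgrPdist_lt/(_ e e0) : (fun k => 10^-1 ^+ k : R) @ \oo --> 0.
    by apply: cvg_expr; rewrite ger0_norm ?invr_ge0// invf_lt1// ltr1n.
  case=> k _ /(_ k (leqnn k)) /=; rewrite sub0r normrN => ke.
  by exists k; rewrite -exprVn; apply: le_lt_trans ke; exact: ler_norm.
pose s := (iter k (cbc Ek) X).1.
(* Xoring [b] with the state [s] leaves the argument [Dk _], which [Ek] sends to the complement of
   the state that [X] reaches at time [k.+1]. *)
pose b := xorb_block s (Dk (negb_block (Ek (xorb_block s (X.2 k))))).
pose Y : phase R N := (X.1, fun j =>
  if (j < k)%N then X.2 j else if j == k then b else negb_block (X.2 j)).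
have XY j : (j < k)%N -> X.2 j = Y.2 j by rewrite /= => ->.
exists Y.
  apply: XeV; rewrite ballEmdist /= mdist_phaseE /dist_phase dist_blockxx add0r.
  exact: le_lt_trans (dist_message_le _ hN XY) ke.
exists k.+1 => //; rewrite mdist_phaseE /dist_phase.
have -> : (iter k.+1 (cbc Ek) Y).1 = negb_block (iter k.+1 (cbc Ek) X).1.
  rewrite !iterS /= !iter_cbc_message addn0 /= ltnn eqxx.
  (* Both trajectories are in state [s] at time [k], since only blocks below [k] have been read. *)
  by rewrite -(@iter_cbc_state _ _ _ X Y)// -/s xorb_blockK hED.
rewrite dist_block_negb ltrD2l.
(* After [k.+1] shifts the leading block is the original block [k.+1], the first one complemented in
   [Y]. *)
apply: lt_le_trans (dist_message_ge _ hN _); first lra.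
by rewrite !iter_cbc_message addn0 /= ltnNge leqnSn /= gtn_eqF.
Qed.
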